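(* If $H\leq F_m$ is a conjugacy reduced and non cyclic finitely generated subgroup, then the entropy $h(L_H)$ of $L_H$ is equal to $\log\lambda$, where $\lambda$ is the maximal eigenvalue (the Perron–Frobenius eigenvalue) of the adjacency matrix $M_{\widehat{\mathcal{D}}_H}$ of the Moore diagram of $\widehat{\mathcal{D}}_H$.
   Context: For a language $L$, $h(L)=\limsup_{n\to\infty}\frac{\log|B_n(L)|}{n}$, where $B_n(L)$ is the set of words of length $n$ in $L$. Automata. The Moore diagram of a finite automaton with states $Q$ and transition function $\delta$ is the directed graph on $Q$ with an edge labelled $x$ from $q$ to $q'$ whenever $\delta$ allows moving from $q$ to $q'$ on reading $x$. The adjacency matrix is indexed by states, its $(q,q')$ entry being the number of edges from $q$ to $q'$. Free group and core. $A=\{a_1,\dots,a_m\}$ is a fixed basis of $F_m$ and $\Sigma=A\cup A^{-1}$. A word over $\Sigma$ is reduced if it has no subword $xx^{-1}$, $x\in\Sigma$. $L_H\subseteq\Sigma^*$ is the set of reduced words (including the empty word) representing elements of $H$. The extended Schreier graph $\widehat\Gamma$ of $H$ has as vertices the right cosets $Hg$, $g\in F_m$, with exactly one edge labelled $x$ from $Hg$ to $Hgx$ for every vertex $Hg$ and every $x\in\Sigma$. The root is $v_0=H$. The extended core $\widehat\Delta_H=(\widehat V,\widehat E,\widehat\mu)$ is the subgraph of $\widehat\Gamma$ consisting of $v_0$ and all vertices and edges lying on closed paths based at $v_0$ with reduced label; it is finite when $H$ is finitely generated. $\widehat\mu(e),t(e)$ are the label and terminus of an edge $e$. If $\widehat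 E$ contains an edge with origin $v$ and label $x$, its terminus is denoted $vx$. The automaton $\widehat{\mathcal{D}}_H$. It has alphabet $\Sigma$, states $\{(v,x)\mid v\in\widehat V,\ x\in\Sigma,\ \exists e\in\widehat E\text{ with }\widehat\mu(e)=x,\ t(e)=v\}$, the set of initial states and the set of final states both equal to the set of states of the form $(v_0,x)$, and transitions $\delta((v,x),y)=(vy,y)$ whenever $y\neq x^{-1}$ and $\widehat E$ has an edge labelled $y$ with origin $v$ (undefined otherwise). $H$ is conjugacy reduced if there is no $a\in\Sigma$ such that every non-empty word of $L_H$ is of the form $a^{-1}wa$; equivalently, there are two non-empty words in $L_H$ with different last letters. *)

(* Defs.v *)
From HB Require Import structures.
From mathcomp Require Import all_boot all_order all_algebra.
From mathcomp Require Import finmap complex.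
From mathcomp Require Import all_classical all_reals all_analysis.

Set Implicit Arguments.
Unset Strict Implicit.
Unset Printing Implicit Defensive.

Import Order.TTheory GRing.Theory Num.Theory.

Local Open Scope classical_set_scope.
Local Open Scope ring_scope.

(* (i, false) stands for a_i and (i, true) for a_i^-1. *)
Notation letter m := ('I_m * bool)%type.

Definition linv m (x : letter m) : letter m := (x.1, ~~ x.2).
Arguments linv : simpl never.

Definition reduced m (w : seq (letter m)) : bool :=
  sorted (fun x y => y != linv x) w.

Definition cons_red m (x : letter m) (w : seq (letter m)) :=
  if w is y :: w' then if y == linv x then w' else x :: w else [:: x].

Definition free_reduce m (w : seq (letter m)) := foldr (@cons_red m) [::] w.

(* F_m is realised on its normal forms: reduced words, multiplied by
   concatenation followed by free reduction. *)
Record free_group m := FreeGroup {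
  fg_word :> seq (letter m);
  fg_wordP : reduced fg_word }.

HB.instance Definition _ m := [isSub for @fg_word m].
HB.instance Definition _ m := [Choice of free_group m by <:].

Section FreeGroupTheory.
Variable m : nat.
Implicit Types (x y : letter m) (u v w : seq (letter m)) (f g h : free_group m).

Lemma linvK : involutive (@linv m).
Proof. by case=> i b; rewrite /linv /= negbK. Qed.

Lemma reduced_behead x w : reduced (x :: w) -> reduced w.
Proof. exact: path_sorted. Qed.

Lemma cons_red_reduced x w : reduced w -> reduced (cons_red x w).
Proof.
case: w => [|y w] //= rw; case: eqP => [_|/eqP yx]; first exact: path_sorted rw.
by rewrite /= yx.
Qed.

Lemma foldr_cons_red_reduced u w :
  reduced w -> reduced (foldr (@cons_red m) w u).
Proof. by move=> rw; elim: u => //= x u; apply: cons_red_reduced. Qed.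

Lemma free_reduce_reduced w : reduced (free_reduce w).
Proof. exact: foldr_cons_red_reduced. Qed.

Lemma cons_redK x w : reduced w -> cons_red x (cons_red (linv x) w) = w.
Proof.
case: w => [|y w] /=; first by rewrite eqxx.
case: eqP => [->|_ _] /=; last by rewrite eqxx.
by rewrite linvK; case: w => [|z w] //= /andP[/negPf -> _].
Qed.

Lemma cons_red_id x w : reduced (x :: w) -> cons_red x w = x :: w.
Proof. by case: w => [|y w] //= /andP[/negPf -> _]. Qed.

Lemma free_reduce_id w : reduced w -> free_reduce w = w.
Proof.
elim: w => [|x w IHw] //= rxw; rewrite IHw; first exact: cons_red_id.
exact: reduced_behead rxw.
Qed.

Lemma foldr_cons_red_reduce w s :
  reduced s -> foldr (@cons_red m) s (free_reduce w) = foldr (@cons_red m) s w.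
Proof.
move=> rs; elim: w => [|x w IHw] //=; rewrite -IHw.
case: (free_reduce w) => [|y u] //=; case: eqP => [->|_] //=.
by rewrite cons_redK //; apply: foldr_cons_red_reduced.
Qed.

Lemma free_reduce_cat u v :
  free_reduce (u ++ v) = foldr (@cons_red m) (free_reduce v) u.
Proof. by rewrite /free_reduce foldr_cat. Qed.

Definition winv w : seq (letter m) := rev (map (@linv m) w).

Lemma reduced_winv w : reduced w -> reduced (winv w).
Proof.
rewrite /reduced /winv rev_sorted sorted_map; apply: sub_sorted => x y.
by rewrite /relpre /= linvK eq_sym.
Qed.

Lemma foldr_winvK w s : reduced s ->
  foldr (@cons_red m) (foldr (@cons_red m) s w) (winv w) = s.
Proof.
move=> rs; elim: w => [|x w IHw] //=.
rewrite /winv map_cons rev_cons foldr_rcons -[in RHS]IHw; congr foldr.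
rewrite -{2}[x]linvK cons_redK //; exact: foldr_cons_red_reduced.
Qed.

Definition fg_one := @FreeGroup m [::] isT.
Definition fg_mul f g := FreeGroup (free_reduce_reduced (f ++ g)).
Definition fg_inv f := FreeGroup (reduced_winv (fg_wordP f)).

Lemma fg_mulA : associative fg_mul.
Proof.
move=> f g h; apply: val_inj; rewrite /=.
rewrite (free_reduce_cat f) (free_reduce_cat (free_reduce _)).
rewrite (free_reduce_id (free_reduce_reduced _)) (free_reduce_id (fg_wordP h)).
rewrite foldr_cons_red_reduce ?fg_wordP // foldr_cat.
by rewrite (free_reduce_cat g) (free_reduce_id (fg_wordP h)).
Qed.

Lemma fg_mul1 : left_id fg_one fg_mul.
Proof. by move=> f; apply: val_inj; rewrite /= free_reduce_id ?fg_wordP. Qed.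

Lemma fg_mulg1 : right_id fg_one fg_mul.
Proof.
by move=> f; apply: val_inj; rewrite /= cats0 free_reduce_id ?fg_wordP.
Qed.

Lemma fg_mulV : left_inverse fg_one fg_inv fg_mul.
Proof.
move=> f; apply: val_inj; rewrite /= free_reduce_cat.
exact: (@foldr_winvK f [::]).
Qed.

Lemma fg_invK : involutive fg_inv.
Proof.
move=> f; apply: val_inj; rewrite /= /winv map_rev revK -map_comp.
by rewrite (eq_map (g := id)) ?map_id // => x /=; rewrite linvK.
Qed.

Lemma fg_mulgV : right_inverse fg_one fg_inv fg_mul.
Proof. by move=> f; rewrite -{1}[f]fg_invK fg_mulV. Qed.

HB.instance Definition _ := isGroup.Build (free_group m)
  fg_mulA fg_mul1 fg_mulg1 fg_mulV fg_mulgV.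

Definition fg_gen x : free_group m := @FreeGroup m [:: x] isT.

Definition fg_eval w : free_group m := (\prod_(x <- w) fg_gen x)%g.

End FreeGroupTheory.

Definition is_subgroup (G : groupType) (H : set G) : Prop :=
  [/\ H 1%g, (forall x y, H x -> H y -> H (x * y)%g)
    & (forall x, H x -> H (x^-1)%g)].

Definition subgroup_generated (G : groupType) (S : set G) : set G :=
  smallest (@is_subgroup G) S.

Definition finitely_generated (G : groupType) (H : set G) : Prop :=
  exists2 S : set G, finite_set S & H = subgroup_generated S.

Definition is_cyclic (G : groupType) (H : set G) : Prop :=
  exists g : G, H = subgroup_generated [set g].

Definition subgroup_language m (H : set (free_group m)) :
    set (seq (letter m)) :=
  [set w | reduced w /\ H (fg_eval w)].

Definition conjugacy_reduced m (H : set (free_group m)) : Prop :=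
  ~ exists a : letter m, forall w, subgroup_language H w -> w <> [::] ->
      exists w', w = linv a :: rcons w' a.

(* The limsup is taken in [-oo, +oo], with log 0 = -oo: L may have no word of
   some lengths. *)
Definition language_entropy (R : realType) (S : finType) (L : set (seq S)) :
    \bar R :=
  limn_esup (fun n : nat =>
    ((n%:R^-1)%:E * lne (#|[pred t : n.-tuple S | `[< L t >]]|%:R%:E))%E).

Record automaton (S : finType) := Automaton {
  state : finType;
  initial : {set state};
  final : {set state};
  delta : state -> S -> option state }.

(* Entry (q, q') counts the edges of the Moore diagram from q to q', i.e. the
   letters x such that reading x in state q leads to q'. *)
Definition adjacency_mx (K : pzRingType) (S : finType) (D : automaton S) :
    'M[K]_#|state D| :=
  \matrix_(i, j) #|[pred x : S | delta (enum_val i) x == Some (enum_val j)]|%:R.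

(* [eigenvalue] is relative to the field of coefficients: the Perron-Frobenius
   eigenvalue is a real eigenvalue bounding the modulus of all complex ones. *)
Definition is_perron_frobenius_eigenvalue (R : realType) (S : finType)
    (D : automaton S) (lambda : R) : Prop :=
  eigenvalue (adjacency_mx R D) lambda /\
  forall z : R[i], eigenvalue (adjacency_mx R[i] D) z ->
    `|z| <= (lambda%:C)%C.

Section ExtendedCore.
Variables (m : nat) (H : set (free_group m)).

Definition rtranslate (v : set (free_group m)) (g : free_group m) :
    set (free_group m) :=
  [set (h * g)%g | h in v].

Definition schreier_vertex : set (set (free_group m)) :=
  range (rtranslate H).

(* There is exactly one edge with given origin and label, so an edge is encoded
   as the pair (origin, label); its terminus is (Hg)x = Hgx. *)
Notation edge := (set (free_group m) * letter m)%type.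

Definition origin (e : edge) := e.1.
Definition label (e : edge) := e.2.
Definition terminus (e : edge) := rtranslate e.1 (fg_gen e.2).

Definition schreier_edge : set edge := [set e | schreier_vertex (origin e)].

Fixpoint schreier_path (v : set (free_group m)) (p : seq edge)
    (v' : set (free_group m)) : Prop :=
  if p is e :: p' then
    [/\ schreier_edge e, origin e = v & schreier_path (terminus e) p' v']
  else v = v'.

(* The root is the coset H itself. *)
Definition reduced_closed_path (p : seq edge) : Prop :=
  schreier_path H p H /\ reduced (map label p).

Definition core_edge : set edge :=
  [set e | exists2 p, reduced_closed_path p & e \in p].

Definition core_vertex : set (set (free_group m)) :=
  [set v | v = H \/
    exists2 e, core_edge e & v = origin e \/ v = terminus e].

Definition core_state_set : set edge :=
  [set q | core_vertex q.1 /\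
    exists e, [/\ core_edge e, label e = q.2 & terminus e = q.1]].

(* [fset_set] turns a finite set into a finite type (and an infinite one into
   the empty type); the extended core of a finitely generated subgroup is
   finite. *)
Definition core_state : finType := fset_set core_state_set.

Definition core_initial : {set core_state} :=
  [set q : core_state | (val q).1 == H].

(* When the condition holds, the pair given to [insub] is a state, so that
   [insub] returns [Some] of it. *)
Definition core_delta (q : core_state) (y : letter m) : option core_state :=
  let: (v, x) := val q in
  if (y != linv x) && `[< core_edge (v, y) >]
  then insub (terminus (v, y), y) else None.

Definition core_automaton : automaton (letter m) :=
  Automaton core_initial core_initial core_delta.

End ExtendedCore.

(* Main.v *)
(* The entries of [M ^+ n], for [M] the adjacency matrix, count the runs of length
   [n] between two states. A nonempty word of [L_H] labels a run starting at an
   initial state, because [H] is conjugacy reduced; conversely every state lies on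
   a reduced loop at the root, so a run between two given states extends, by a
   prefix and a suffix of fixed lengths, to a word of [L_H]. Hence [|B_n(L_H)|] and
   the sum of the entries of [M ^+ n] have the same exponential growth rate. That
   rate is the infimum of the [c] admitting a positive row vector [x] with
   [x M <= c x], which is an eigenvalue of [M] and bounds all the others. *)

Require Import Defs.
From mathcomp Require Import all_boot all_order all_algebra.
From mathcomp Require Import finmap complex.
From mathcomp Require Import all_classical all_reals all_analysis.

Set Implicit Arguments.
Unset Strict Implicit.
Unset Printing Implicit Defensive.

Import Order.TTheory GRing.Theory Num.Theory.
Import numFieldNormedType.Exports.

Local Open Scope classical_set_scope.
Local Open Scope ring_scope.

(** * Nonnegative matrices *)

Definition nonneg_mx (R : numDomainType) p q (M : 'M[R]_(p, q)) : Prop :=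
  forall i j, 0 <= M i j.

(** An inequality rather than an eigenvector equation, because the Perron eigenvector of a reducible
    matrix may have zero entries. *)
Definition subinvariant (R : numDomainType) n (M : 'M[R]_n) (c : R)
    (x : 'rV[R]_n) : Prop :=
  (forall i, 0 < x 0 i) /\ forall j, (x *m M) 0 j <= c * x 0 j.

Lemma nonneg_mulmx (R : numDomainType) p q r (A : 'M[R]_(p, q))
    (B : 'M[R]_(q, r)) : nonneg_mx A -> nonneg_mx B -> nonneg_mx (A *m B).
Proof.
by move=> A0 B0 i j; rewrite mxE sumr_ge0// => k _; rewrite mulr_ge0.
Qed.

Lemma nonneg_mxX (R : numDomainType) n (M : 'M[R]_n) k :
  nonneg_mx M -> nonneg_mx (M ^+ k).
Proof.
move=> M0; elim: k => [|k IHk]; last by rewrite exprS; exact: nonneg_mulmx.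
by move=> i j; rewrite expr0 mxE ler0n.
Qed.

(* Minimum principle: compare [y] with [t *: x], where [t] is the least ratio
   [y 0 i / x 0 i]. *)
Lemma subinvariant_min (R : realFieldType) n (M : 'M[R]_n) c c' x (y : 'rV_n) :
  nonneg_mx M -> subinvariant M c' x -> c' < c ->
  (forall j, (y *m M) 0 j <= c * y 0 j) -> nonneg_mx y.
Proof.
move=> M0 [x0 xM] c'c yM i0 k; rewrite (ord1 i0) {i0}.
case: (@arg_minP _ _ _ k predT (fun i => y 0 i / x 0 i)) => //= i _ tmin.
set t := y 0 i / x 0 i in tmin.
have yi : y 0 i = t * x 0 i by rewrite /t divfK ?gt_eqF.
have ytx j : t * x 0 j <= y 0 j by rewrite -ler_pdivlMr ?tmin.
have [t0|t0] := leP 0 t; first by apply: le_trans (ytx k); rewrite mulr_ge0// ltW.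
(* If [t < 0], then at the minimising index [t c' x_i <= t (x M)_i <= (y M)_i <= c y_i = t c x_i],
   which contradicts [c' < c]. *)
suff : t * c' * x 0 i <= t * c * x 0 i by rewrite ler_pM2r// ler_nM2l// leNgt c'c.
rewrite -[leRHS]mulrA [c * _]mulrC mulrA -yi mulrC.
rewrite [leRHS]mulrC; apply: le_trans (yM i).
apply: (@le_trans _ _ (t * (x *m M) 0 i)).
  by rewrite mulrC -mulrA ler_nM2l.
by rewrite !mxE mulr_sumr ler_sum// => j _; rewrite mulrA ler_wpM2r.
Qed.

(** When [A] is invertible, [y] is [\det A ^+ 2] times [u A^-1]. The extra factor [\det A] turns the
    coefficient of [u] into a square, so its sign is known. *)
Lemma row_mul_adj_sub (R : comNzRingType) n (M : 'M[R]_n) c (u : 'rV_n) :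
  let A := c%:M - M in
  let y := u *m (\det A *: \adj A) in
  y *m M = c *: y - \det A ^+ 2 *: u.
Proof.
move=> A y; have -> : M = c%:M - A by rewrite /A opprB addrC subrK.
rewrite mulmxBr mul_mx_scalar; congr (_ - _).
by rewrite /y -mulmxA -scalemxAl mul_adj_mx scale_scalar_mx mul_mx_scalar expr2.
Qed.

Lemma poly_ge0_right (R : realType) (p : {poly R}) a :
  (forall c, a < c -> 0 <= p.[c]) -> 0 <= p.[a].
Proof.
move=> p0; rewrite leNgt; apply/negP => pa.
have e0 : 0 < - p.[a] by rewrite oppr_gt0.
have [d d0 pd] := @polyrcf.poly_cont R a p _ e0.
have d2 : 0 < d / 2 by rewrite divr_gt0.
have := pd (a + d / 2); rewrite addrC addKr ger0_norm ?ltW//.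
rewrite ltr_pdivrMr// ltr_pMr// ltr1n => /(_ isT).
rewrite ltr_norml => /andP[_]; rewrite ltrBlDr addNr; apply/negP.
by rewrite -leNgt p0// ltrDl.
Qed.

(* The nonnegativity of [det * adj] of [c%:M - M] says that the resolvent is
   nonnegative where it exists; it extends from [c > a] to [c = a]. *)
Lemma det_adj_ge0 (R : realType) n (M : 'M[R]_n) a :
  nonneg_mx M -> (forall c, a < c -> exists x, subinvariant M c x) ->
  nonneg_mx (\det (a%:M - M) *: \adj (a%:M - M)).
Proof.
move=> M0 subM i j.
(* [char_poly_mx M] evaluates at [c] to [c%:M - M], so the entry is the value at [c] of a fixed
   polynomial. *)
pose p := (\det (char_poly_mx M) *: \adj (char_poly_mx M)) i j.
have pE c : p.[c] = (\det (c%:M - M) *: \adj (c%:M - M)) i j.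
  have -> : c%:M - M = map_mx (horner_eval c) (char_poly_mx M).
    apply/matrixP => k l; rewrite !mxE /= /horner_eval !hornerE.
    by case: (k == l); rewrite ?mulr1n ?mulr0n ?hornerE.
  rewrite -map_mx_adj det_map_mx /p !mxE hornerM /=; congr (_ * _).
rewrite -pE; apply: poly_ge0_right => c ac; rewrite pE.
(* The minimum principle needs a constant strictly below [c]; the midpoint of [a] and [c] serves. *)
have [x xM] := subM _ (midf_lt ac).1.
set B := \det _ *: _.
have yM k : (row i 1%:M *m B *m M) 0 k <= c * (row i 1%:M *m B) 0 k.
  rewrite row_mul_adj_sub [leLHS]mxE [X in X + _]mxE gerDl [leLHS]mxE oppr_le0.
  by rewrite !mxE mulr_ge0 ?sqr_ge0.
by have := subinvariant_min M0 xM (midf_lt ac).2 yM 0 j; rewrite -row_mul mul1mx mxE.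
Qed.

(* The eigenvalue is the infimum [a] of the Collatz-Wielandt set. Were it not an
   eigenvalue, the row vector [1 (a - M)^-1] would be nonnegative by the previous
   lemma, and subinvariant for some [c < a]. *)
Lemma nonneg_mx_eigenvalue (R : realType) n (M : 'M[R]_n) :
  (0 < n)%N -> nonneg_mx M ->
  exists a : R, [/\ 0 <= a, eigenvalue M a
    & forall c, a < c -> exists x, subinvariant M c x].
Proof.
case: n M => // n M _ M0.
pose E : set R := [set c | exists x, subinvariant M c x].
have E_ge0 c : E c -> 0 <= c.
  move=> [x [x0 xM]]; rewrite -(pmulr_lge0 _ (x0 0)).
  by apply: le_trans (xM 0); apply: nonneg_mulmx => // i j; rewrite (ord1 i) ltW.
have infE : has_inf E.
  split; last by exists 0 => c /E_ge0.
  (* For the all-ones vector any common bound on the column sums works, such as the sum of all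
     entries. *)
  exists (\sum_i \sum_j M i j), (const_mx 1); split=> [i|j]; rewrite !mxE//.
  rewrite mulr1 ler_sum// => i _; rewrite mxE mul1r.
  by rewrite (bigD1 j)//= lerDl sumr_ge0.
pose a := inf E.
have a_sub c : a < c -> exists x, subinvariant M c x.
  move=> /(inf_lt infE.1)[b [x [x0 xM]] bc].
  exists x; split=> // j; apply: le_trans (xM j) _.
  by rewrite ler_wpM2r// ltW.
exists a; split=> //; first by apply: lb_le_inf; [case: infE|move=> c /E_ge0].
apply: contraT => /negP aM.
pose A := a%:M - M.
have dA : \det A != 0.
  apply/negP => /det0P[v v0 vA]; apply: aM; apply/eigenvalueP; exists v => //.
  by apply/eqP; rewrite -mul_mx_scalar -subr_eq0 -opprB -mulmxBr vA oppr0.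
pose x : 'rV_n.+1 := const_mx 1 *m (\det A *: \adj A).
have x0 j : 0 <= x 0 j.
  by apply: nonneg_mulmx; [move=> ? ?; rewrite mxE|exact: det_adj_ge0].
have d0 : 0 < \det A ^+ 2 by rewrite lt0r sqr_ge0 expf_neq0.
have xM j : (x *m M) 0 j = a * x 0 j - \det A ^+ 2.
  by rewrite row_mul_adj_sub -/A -/x !mxE mulr1.
have x_gt0 j : 0 < x 0 j.
  rewrite lt0r x0 andbT; apply/eqP => xj0.
  have : 0 <= (x *m M) 0 j.
    by apply: nonneg_mulmx => // i k; rewrite (ord1 i).
  by rewrite xM xj0 mulr0 sub0r oppr_ge0 leNgt d0.
pose s := \sum_j x 0 j.
have xs j : x 0 j <= s by rewrite /s (bigD1 j)//= lerDl sumr_ge0.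
have s0 : 0 < s by exact: lt_le_trans (x_gt0 0) (xs 0).
(* As [x 0 j <= s], the defect [\det A ^+ 2] in [xM] is at least [(\det A ^+ 2 / s) * x 0 j]. *)
have : E (a - \det A ^+ 2 / s).
  exists x; split=> // j; rewrite xM mulrBl lerB// mulrAC ler_pdivrMr//.
  by rewrite ler_wpM2l// ltW.
move=> /(ge_inf infE.2); rewrite -/a leNgt => /negP[].
by rewrite gtrBl divr_gt0.
Qed.

Lemma normc_sum (R : rcfType) (I : Type) (r : seq I) (F : I -> R[i]) :
  Normc.normc (\sum_(i <- r) F i)
    <= \sum_(i <- r) Normc.normc (F i).
Proof.
by rewrite -lecR rmorph_sum; apply: (@ler_norm_sum _ R[i]).
Qed.

(** Taking moduli in [v M = z v] gives [|z| |v| <= |v| M]. If [|z| > c], the minimum principle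
    applies to [- |v|] and forces [v = 0]. *)
Lemma subinvariant_complex_eigenvalue (R : rcfType) n (M : 'M[R]_n) c x z :
  nonneg_mx M -> subinvariant M c x ->
  eigenvalue (map_mx (real_complex R) M) z -> Normc.normc z <= c.
Proof.
move=> M0 xM /eigenvalueP[v vM /negP v0].
rewrite leNgt; apply/negP => cz; apply: v0; apply/eqP.
pose a : 'rV[R]_n := map_mx (@Normc.normc R) v.
have a0 j : 0 <= - a 0 j.
  have := @subinvariant_min _ _ M _ _ x (- a) M0 xM cz.
  move=> /(_ _ 0 j); rewrite mxE; apply=> k.
  rewrite mulNmx !mxE mulrN lerN2 -Normc.normcM.
  have /rowP/(_ k) := vM; rewrite !mxE => <-.
  apply: le_trans (normc_sum _ _) _; apply: ler_sum => i _.
  by rewrite Normc.normcM !mxE /= expr0n addr0 sqrtr_sqr ger0_norm.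
apply/rowP => j; rewrite [RHS]mxE; apply: Normc.eq0_normc.
apply/eqP; rewrite eq_le; apply/andP; split.
  by have := a0 j; rewrite mxE oppr_ge0.
by case: (v 0 j) => ? ?; rewrite sqrtr_ge0.
Qed.

(** Iteration gives [x M^k <= c^k x]; keeping one term of the left side bounds each entry of [M^k]
    by [c^k x_j / x_i]. *)
Lemma subinvariant_sum_mxX (R : numFieldType) n (M : 'M[R]_n) c x :
  nonneg_mx M -> 0 <= c -> subinvariant M c x ->
  forall k, \sum_i \sum_j (M ^+ k) i j
    <= (\sum_i \sum_j x 0 j / x 0 i) * c ^+ k.
Proof.
move=> M0 c0 [x0 xM] k.
have xMk j : (x *m M ^+ k) 0 j <= c ^+ k * x 0 j.
  elim: k j => [|k IHk] j; first by rewrite expr0 mulmx1 mul1r.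
  rewrite (exprSr M k : _ = M ^+ k *m M) mulmxA.
  apply: (@le_trans _ _ (c ^+ k * (x *m M) 0 j)); last first.
    by rewrite exprSr -mulrA ler_wpM2l ?exprn_ge0.
  rewrite [leLHS]mxE [in leRHS]mxE mulr_sumr ler_sum// => i _.
  by rewrite mulrA ler_wpM2r.
rewrite mulr_suml ler_sum// => i _; rewrite mulr_suml ler_sum// => j _.
rewrite mulrAC ler_pdivlMr// mulrC [leRHS]mulrC; apply: le_trans (xMk j).
rewrite mxE (bigD1 i)//= lerDl sumr_ge0// => l _.
by rewrite mulr_ge0 ?nonneg_mxX// ltW.
Qed.

(** Compare moduli at a coordinate [j] of [v M^k = a^k v] where [v] does not vanish. *)
Lemma eigenvalue_sum_mxX (R : numFieldType) n (M : 'M[R]_n) a :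
  nonneg_mx M -> 0 <= a -> eigenvalue M a ->
  exists2 b, 0 < b & forall k, b * a ^+ k <= \sum_i \sum_j (M ^+ k) i j.
Proof.
move=> M0 a0 /eigenvalueP[v vM /rV0Pn[j vj0]].
have vMk k : v *m M ^+ k = a ^+ k *: v.
  elim: k => [|k IHk]; first by rewrite !expr0 mulmx1 scale1r.
  by rewrite (exprSr M k : _ = M ^+ k *m M) mulmxA IHk -scalemxAl vM scalerA exprSr.
pose V := \sum_i `|v 0 i|.
have vV i : `|v 0 i| <= V by rewrite /V (bigD1 i)//= lerDl sumr_ge0.
have V0 : 0 < V by apply: lt_le_trans (vV j); rewrite normr_gt0.
exists (`|v 0 j| / V) => [|k]; first by rewrite divr_gt0 ?normr_gt0.
rewrite mulrAC ler_pdivrMr// -{1}(ger0_norm (exprn_ge0 k a0)) -normrM mulrC.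
have /rowP/(_ j) := vMk k; rewrite !mxE => <-.
apply: le_trans (ler_norm_sum _ _ _) _.
rewrite mulr_suml ler_sum// => i _; rewrite normrM mulrC ler_pM//.
rewrite ger0_norm ?nonneg_mxX// (bigD1 j)//= lerDl sumr_ge0// => l _.
exact: nonneg_mxX.
Qed.

(** * Schreier graphs and finiteness of the core *)

Section FreeGroupWords.
Variable m : nat.
Implicit Types (x y : letter m) (u v w : seq (letter m)) (g h : free_group m).

Lemma fg_eval_nil : fg_eval [::] = 1%g :> free_group m.
Proof. by rewrite /fg_eval big_nil. Qed.

Lemma fg_eval_cons x w : fg_eval (x :: w) = (fg_gen x * fg_eval w)%g.
Proof. by rewrite /fg_eval big_cons. Qed.

Lemma fg_eval_cat u v : fg_eval (u ++ v) = (fg_eval u * fg_eval v)%g.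
Proof. by rewrite /fg_eval big_cat. Qed.

Lemma fg_eval_rcons u x : fg_eval (rcons u x) = (fg_eval u * fg_gen x)%g.
Proof. by rewrite -cats1 fg_eval_cat fg_eval_cons fg_eval_nil mulg1. Qed.

Lemma fg_word_eval w : fg_word (fg_eval w) = free_reduce w.
Proof.
elim: w => [|x w IHw]; first by rewrite fg_eval_nil.
rewrite fg_eval_cons /= IHw (free_reduce_id (free_reduce_reduced _)) //.
Qed.

Lemma fg_eval_word g : fg_eval (fg_word g) = g.
Proof. by apply: val_inj; rewrite /= fg_word_eval free_reduce_id ?fg_wordP. Qed.

Lemma fg_gen_linv x : fg_gen (linv x) = (fg_gen x)^-1%g.
Proof. exact: val_inj. Qed.

Lemma fg_eval_winv w : fg_eval (winv w) = (fg_eval w)^-1%g.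
Proof.
elim: w => [|x w IHw]; first by rewrite fg_eval_nil invg1.
by rewrite /winv map_cons rev_cons fg_eval_rcons IHw fg_gen_linv fg_eval_cons invgM.
Qed.

Lemma winv_cat u v : winv (u ++ v) = winv v ++ winv u.
Proof. by rewrite /winv map_cat rev_cat. Qed.

Lemma winvK : involutive (@winv m).
Proof.
move=> w; rewrite /winv map_rev revK -map_comp -[RHS]map_id.
by apply: eq_map => x; exact: linvK.
Qed.

End FreeGroupWords.

Section Cosets.
Variable m : nat.
Implicit Types (v : set (free_group m)) (g h : free_group m).
Implicit Types (w : seq (letter m)) (e : set (free_group m) * letter m).

Lemma rtranslateM v g h : rtranslate (rtranslate v g) h = rtranslate v (g * h)%g.
Proof.
rewrite /rtranslate image_comp; apply: eq_imagel => f _ /=.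
by rewrite mulgA.
Qed.

Lemma rtranslate1 v : rtranslate v 1%g = v.
Proof.
rewrite -[RHS]image_id; apply: eq_imagel => f _ /=; exact: mulg1.
Qed.

Lemma rtranslateK v g : rtranslate (rtranslate v g) g^-1%g = v.
Proof. by rewrite rtranslateM mulgV rtranslate1. Qed.

(** The edges of the Schreier path from [v] labelled [w]. *)
Fixpoint trav v w : seq (set (free_group m) * letter m) :=
  if w is x :: w' then (v, x) :: trav (rtranslate v (fg_gen x)) w' else [::].

Lemma trav_cat v w1 w2 :
  trav v (w1 ++ w2) = trav v w1 ++ trav (rtranslate v (fg_eval w1)) w2.
Proof.
elim: w1 v => [|x w1 IHw] v /=; first by rewrite fg_eval_nil rtranslate1.
by rewrite IHw rtranslateM fg_eval_cons.
Qed.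

Lemma map_label_trav v w : map (@label m) (trav v w) = w.
Proof. by elim: w v => //= x w IHw v; rewrite IHw. Qed.

Lemma mem_trav v w e : e \in trav v w <->
  exists u t, w = u ++ e.2 :: t /\ e.1 = rtranslate v (fg_eval u).
Proof.
split=> [|[u [t [-> e1]]]]; last first.
  by rewrite trav_cat mem_cat /= -e1 -surjective_pairing mem_head orbT.
elim: w v => //= x w IHw v; rewrite inE => /orP[/eqP->|/IHw[u [t [-> e1]]]].
  by exists [::], w; rewrite fg_eval_nil rtranslate1.
by exists (x :: u), t; rewrite fg_eval_cons -rtranslateM.
Qed.

Lemma schreier_vertex_translate (H : set (free_group m)) g :
  schreier_vertex H (rtranslate H g).
Proof. by exists g. Qed.

(** Each vertex has exactly one outgoing edge per letter, so origin and label determine a path. *)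
Lemma schreier_pathP (H : set (free_group m)) v p v' : schreier_vertex H v ->
  schreier_path H v p v' <->
  p = trav v (map (@label m) p) /\ rtranslate v (fg_eval (map (@label m) p)) = v'.
Proof.
elim: p v => [|[v1 x] p IHp] v Hv /=.
  by rewrite fg_eval_nil rtranslate1; split=> [|[]].
have Hvx : schreier_vertex H (rtranslate v (fg_gen x)).
  by case: Hv => g _ <-; rewrite rtranslateM; exact: schreier_vertex_translate.
rewrite fg_eval_cons -rtranslateM /terminus /origin /=; split.
  by move=> [_ -> /(IHp _ Hvx)[<- ->]].
by move=> [[-> pE] v'E]; split=> //; apply/IHp.
Qed.

(** Cancelling [x] against [linv x] deletes a step forth and back, after which the path resumes from
    the same vertex. *)
Lemma trav_foldr_cons_red v u w :
  {subset trav v (foldr (@cons_red m) w u) <= trav v (u ++ w)}.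
Proof.
elim: u v => [|x u IHu] v e //=.
have : {subset trav v (x :: foldr (@cons_red m) w u) <=
        (v, x) :: trav (rtranslate v (fg_gen x)) (u ++ w)}.
  by move=> f; rewrite /= !inE => /orP[->//|/IHu->]; rewrite orbT.
case: (foldr _ _ _) => [|y s] /= sub; first exact: sub.
case: eqP => [yx es|_]; last exact: sub.
apply: sub; rewrite !inE; apply/orP; right; apply/orP; right.
by rewrite yx rtranslateM fg_gen_linv mulgV rtranslate1.
Qed.

Definition inv_edge e := (terminus e, linv e.2).

Lemma inv_edgeK : involutive inv_edge.
Proof.
case=> v x; rewrite /inv_edge /terminus /= linvK fg_gen_linv.
by rewrite rtranslateK.
Qed.

End Cosets.

Section SubgroupCore.
Variables (m : nat) (H : set (free_group m)).
Hypothesis subH : is_subgroup H.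
Implicit Types (g h : free_group m) (u w t : seq (letter m)).

Let H1 : H 1%g. Proof. by case: subH. Qed.
Let HM x y : H x -> H y -> H (x * y)%g. Proof. by case: subH => _ + _; apply. Qed.
Let HV x : H x -> H (x^-1)%g. Proof. by case: subH => _ _; apply. Qed.

Lemma rtranslate_id g : rtranslate H g = H <-> H g.
Proof.
split=> [<-|Hg]; first by exists 1%g => //; rewrite mul1g.
apply/seteqP; split=> [_ [h Hh <-]|h Hh]; first exact: HM.
by exists (h * g^-1)%g; [apply: HM => //; exact: HV|rewrite -mulgA mulVg mulg1].
Qed.

Lemma subgroup_languageP w :
  subgroup_language H w <-> reduced w /\ rtranslate H (fg_eval w) = H.
Proof. by rewrite /subgroup_language /= rtranslate_id. Qed.

(** Trades closed paths for words: [u] is what is read before crossing [e], and [t] what is read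
    after. *)
Lemma core_edgeP e : core_edge H e <->
  exists u t, e.1 = rtranslate H (fg_eval u) /\
              subgroup_language H (u ++ e.2 :: t).
Proof.
have HH : schreier_vertex H H.
  by rewrite -[X in _ X]rtranslate1; exact: schreier_vertex_translate.
split=> [[p [pH rp] ep]|[u [t [e1 /subgroup_languageP[ruet Hu]]]]].
  move: pH => /(schreier_pathP _ _ HH)[pE Hp].
  move: ep; rewrite pE => /mem_trav[u [t [uE e1]]]; exists u, t; split=> //.
  by rewrite -uE; apply/subgroup_languageP.
exists (trav H (u ++ e.2 :: t)); last by apply/mem_trav; exists u, t.
by split; rewrite ?(schreier_pathP _ _ HH) map_label_trav.
Qed.

Lemma core_state_setP q : core_state_set H q <->
  exists u t, q.1 = rtranslate H (fg_eval (rcons u q.2)) /\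
              subgroup_language H (u ++ q.2 :: t).
Proof.
split=> [[_ [e [/core_edgeP[u [t [e1 Le]]] <- <-]]]|[u [t [q1 Lq]]]].
  by exists u, t; rewrite fg_eval_rcons -rtranslateM -e1.
have ce : core_edge H (rtranslate H (fg_eval u), q.2).
  by apply/core_edgeP; exists u, t.
have te : terminus (rtranslate H (fg_eval u), q.2) = q.1.
  by rewrite /terminus /= rtranslateM -fg_eval_rcons.
split; last by exists (rtranslate H (fg_eval u), q.2).
by right; exists (rtranslate H (fg_eval u), q.2) => //; right.
Qed.

Lemma subgroup_language_winv w :
  subgroup_language H w -> subgroup_language H (winv w).
Proof.
move=> [rw Hw]; split; first exact: reduced_winv.
by rewrite fg_eval_winv; exact: HV.
Qed.

(* With [E] the edges on the loops reading a generating set, and their inverses,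
   this says that the core lies in [E]: free reduction only erases edges. *)
Lemma subgroup_traverse (E : set (set (free_group m) * letter m)) :
  (forall e, E e -> E (inv_edge e)) ->
  is_subgroup [set g | H g /\ forall e, e \in trav H (fg_word g) -> E e].
Proof.
move=> EV; split=> [|f g [Hf fE] [Hg gE]|g [Hg gE]]; first by split.
  split=> [|e]; first exact: HM.
  rewrite /= free_reduce_cat (free_reduce_id (fg_wordP g)).
  move=> /trav_foldr_cons_red; rewrite trav_cat mem_cat => /orP[/fE//|].
  by rewrite fg_eval_word (rtranslate_id f).2//; exact: gE.
split=> [|e]; first exact: HV.
rewrite /= => /mem_trav[u [t [uE e1]]].
(* If the loop of [g^-1] crosses [e] between [u] and [t], the loop of [g] crosses [inv_edge e]
   between [winv t] and [winv u]. *)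
have gw : fg_word g = rcons (winv t) (linv e.2) ++ winv u.
  have := congr1 (@winv m) uE; rewrite winvK winv_cat => ->.
  by rewrite {1}/winv map_cons rev_cons.
rewrite -[e]inv_edgeK; apply: EV; apply: gE; apply/mem_trav.
exists (winv t), (winv u); rewrite gw cat_rcons /=; split=> //.
have Hgt : (fg_eval u * fg_gen e.2 = g^-1 * (fg_eval t)^-1)%g.
  rewrite -[g in RHS]fg_eval_word -(fg_eval_winv g) uE fg_eval_cat fg_eval_cons.
  by rewrite mulgA mulgK.
rewrite /terminus e1 rtranslateM Hgt -rtranslateM fg_eval_winv.
by rewrite (rtranslate_id _).2//; exact: HV.
Qed.

(** The loops of finitely many generators cross finitely many edges, and every state is the terminus
    and label of one of these or of their inverses. *)
Lemma finite_core_state_set : finitely_generated H -> finite_set (core_state_set H).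
Proof.
move=> [S finS HS].
pose E0 : set (set (free_group m) * letter m) :=
  \bigcup_(s in S) [set` trav H (fg_word s)].
pose E := E0 `|` @inv_edge m @` E0.
have finE0 : finite_set E0 by apply: bigcup_finite => // s _; exact: finite_seq.
have finE : finite_set E by rewrite finite_setU; split=> //; exact: finite_image.
have EV e : E e -> E (inv_edge e).
  case=> [E0e|[f E0f <-]]; first by right; exists e.
  by left; rewrite inv_edgeK.
have HE : H `<=` [set g | H g /\ forall e, e \in trav H (fg_word g) -> E e].
  rewrite {1}HS; apply: smallest_sub; first exact: subgroup_traverse.
  move=> s Ss; split; first by rewrite HS; exact: sub_gen_smallest.
  by move=> e es; left; exists s.
apply: (@sub_finite_set _ _ ((fun e => (terminus e, e.2)) @` E)); last first.
  exact: finite_image.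
move=> [v x] /core_state_setP[u [t /= [-> [ru Hu]]]].
exists (rtranslate H (fg_eval u), x); last first.
  by rewrite /terminus /= rtranslateM fg_eval_rcons.
have [_] := HE _ Hu; apply; apply/mem_trav; exists u, t.
by rewrite fg_word_eval free_reduce_id.
Qed.

End SubgroupCore.

(** * Runs of the core automaton *)

Section AutomatonRuns.
Variables (S : finType) (D : automaton S).
Implicit Types (q p : state D) (w : seq S).

Fixpoint run q w : option (state D) :=
  if w is x :: w' then (if delta q x is Some p then run p w' else None)
  else Some q.

Definition run_count n q p : nat := \sum_(t : n.-tuple S) (run q t == Some p).

Lemma big_tuple_cons (F : seq S -> nat) n :
  (\sum_(t : n.+1.-tuple S) F t = \sum_x \sum_(t : n.-tuple S) F (x :: t))%N.
Proof.
rewrite pair_big /= (reindex (fun p : S * n.-tuple S => [tuple of p.1 :: p.2])) //=.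
exists (fun t => (thead t, [tuple of behead t])) => [[x t] _|t _] /=.
  by congr pair; apply: val_inj.
by rewrite -tuple_eta.
Qed.

Lemma run_count0 q p : run_count 0 q p = (q == p).
Proof. by rewrite /run_count (big_pred1 [tuple]) // => t; rewrite [t]tuple0. Qed.

Lemma run_countS n q p :
  run_count n.+1 q p =
  (\sum_k #|[pred x : S | delta q x == Some k]| * run_count n k p)%N.
Proof.
rewrite /run_count (big_tuple_cons (fun w => (run q w == Some p) : nat)).
under [RHS]eq_bigr do rewrite -sum1_card big_mkcond big_distrl /=.
rewrite [RHS]exchange_big /=; apply: eq_bigr => x _.
under [RHS]eq_bigr => k _ do rewrite inE.
case: (delta q x) => [k|]; last by rewrite big1// big1.
rewrite (bigD1 k)//= eqxx mul1n [X in (_ + X)%N]big1 ?addn0// => l lk.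
by rewrite (inj_eq Some_inj) eq_sym (negPf lk).
Qed.

Lemma adjacency_mxX (K : pzRingType) n i j :
  (adjacency_mx K D ^+ n) i j = (run_count n (enum_val i) (enum_val j))%:R.
Proof.
elim: n i => [|n IHn] i.
  by rewrite expr0 mxE run_count0 (inj_eq enum_val_inj).
rewrite exprS mxE run_countS natr_sum [RHS](reindex_onto enum_val enum_rank) /=.
  by apply: eq_big => [k|k _]; rewrite ?enum_valK ?eqxx// mxE IHn natrM.
by move=> k _; rewrite enum_rankK.
Qed.

Lemma sum_adjacency_mxX (K : pzRingType) n :
  \sum_i \sum_j (adjacency_mx K D ^+ n) i j = (\sum_q \sum_p run_count n q p)%:R.
Proof.
have sumE (F : state D -> nat) : 
    (\sum_q F q = \sum_(i < #|state D|) F (enum_val i))%N.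
  rewrite (reindex_onto (@enum_val _ (state D)) enum_rank) /=.
    by apply: eq_bigl => k; rewrite enum_valK eqxx.
  by move=> k _; rewrite enum_rankK.
rewrite sumE natr_sum; apply: eq_bigr => i _.
by rewrite sumE natr_sum; apply: eq_bigr => j _; rewrite adjacency_mxX.
Qed.

End AutomatonRuns.

Definition word_count (S : finType) (L : set (seq S)) n : nat :=
  #|[pred t : n.-tuple S | `[< L t >]]|.

(** Padding with the fixed words [a] and [b] is injective. *)
Lemma run_count_le_word_count (S : finType) (D : automaton S) (L : set (seq S))
    (a b : seq S) (q p : state D) :
  (forall w, run q w = Some p -> L (a ++ w ++ b)) ->
  forall n, (run_count n q p <= word_count L (n + (size a + size b)))%N.
Proof.
move=> runL n; rewrite addnCA /run_count /word_count -big_mkcond sum1_card.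
pose f (t : n.-tuple S) := [tuple of in_tuple a ++ (t ++ in_tuple b)].
have f_inj : injective f.
  move=> s t /(congr1 val)/= /eqP; rewrite eqseq_cat// eqxx eqseq_cat ?size_tuple//.
  by move=> /= /andP[/eqP st _]; apply: val_inj.
rewrite -(fintype.card_image f_inj).
apply: subset_leq_card; apply/fintype.subsetP => _ /fintype.imageP[t tp ->].
have Lft : L (f t) by apply: (runL t); apply/eqP.
exact: (asboolT Lft).
Qed.

(** With the sum over words outermost, each word of [L] contributes at least its own run. *)
Lemma word_count_le_run_count (S : finType) (D : automaton S) (L : set (seq S)) n :
  (forall w, size w = n -> L w -> exists q p : state D, run q w = Some p) ->
  (word_count L n <= \sum_q \sum_(p : state D) run_count n q p)%N.
Proof.
move=> Lrun; rewrite /run_count; under eq_bigr do rewrite exchange_big.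
rewrite exchange_big /word_count -sum1_card big_mkcond leq_sum// => t _.
rewrite inE; case: asboolP => // /(Lrun _ (size_tuple t))[q [p qp]].
by rewrite (bigD1 q)//= (bigD1 p)//= qp eqxx.
Qed.

Section CoreRuns.
Variables (m : nat) (H : set (free_group m)).
Hypothesis subH : is_subgroup H.
Hypothesis fgH : finitely_generated H.
Implicit Types (q : state (core_automaton H)) (w : seq (letter m)).

Lemma core_stateP (q : core_state H) : core_state_set H (val q).
Proof.
have := valP q; rewrite in_fset_set; last exact: finite_core_state_set.
by move/set_mem.
Qed.

Lemma core_state_exists v : core_state_set H v ->
  exists q : state (core_automaton H), val q = v.
Proof.
move=> Hv.
have v_in : v \in fset_set (core_state_set H).
  by rewrite in_fset_set; [exact/mem_set|exact: finite_core_state_set].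
by exists (FSetSub v_in).
Qed.

Lemma core_deltaP q y p : delta q y = Some p ->
  y != linv (val q).2 /\ val p = (terminus ((val q).1, y), y).
Proof.
change (delta q y) with (core_delta q y); rewrite /core_delta.
case: (val q) => v x; case: ifP => // /andP[yx _].
by case: insubP => // p' _ p'E [<-].
Qed.

Lemma core_run_sound q w p : run q w = Some p ->
  [/\ reduced ((val q).2 :: w), (val p).2 = last (val q).2 w
    & (val p).1 = rtranslate (val q).1 (fg_eval w)].
Proof.
elim: w q => [|y w IHw] q /=.
  by move=> [->]; rewrite fg_eval_nil rtranslate1.
case qy : (core_delta q y) => [k|] // /IHw[].
have [yq kE] := core_deltaP qy; rewrite kE /= => rw -> ->.
by rewrite yq /terminus rtranslateM -fg_eval_cons.
Qed.

(** Letters pass from [w] to [u] while [u ++ w ++ t] stays the same word of [L_H], which witnesses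
    every edge crossed. The letter stored in [q] is not tied to [u], so a run may start at the root
    with any incoming letter that [w] does not cancel. *)
Lemma core_run_complete w q u t :
  (val q).1 = rtranslate H (fg_eval u) -> subgroup_language H (u ++ w ++ t) ->
  reduced ((val q).2 :: w) -> exists p, run q w = Some p.
Proof.
elim: w q u => [|y w IHw] q u qu Lw; first by exists q.
move=> /= /andP[yq rw].
have [k kE] : exists k : state (core_automaton H),
    val k = (terminus ((val q).1, y), y).
  apply: core_state_exists; apply/core_state_setP => //; exists u, (w ++ t).
  by rewrite /terminus /= qu rtranslateM fg_eval_rcons.
have -> : core_delta q y = Some k.
  rewrite /core_delta [val q]surjective_pairing yq /= asboolT; last first.
    by apply/core_edgeP => //; exists u, (w ++ t).
  by rewrite -kE valK.
apply: (IHw k (rcons u y)); rewrite ?kE ?cat_rcons//.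
by rewrite /terminus /= qu rtranslateM fg_eval_rcons.
Qed.

(** [a] leads from the root into [q], and [b] from [p] back to the root. Both junctions are reduced
    because a state remembers the last letter read. *)
Lemma core_run_extend q p : exists a b, forall w, run q w = Some p ->
  subgroup_language H (a ++ w ++ b).
Proof.
have /(core_state_setP subH)[u [t [qu [ruqt _]]]] := core_stateP q.
have /(core_state_setP subH)[u' [t' [pu' /(subgroup_languageP subH)[rupt Hup]]]] :=
  core_stateP p.
exists (rcons u (val q).2), t' => w /core_run_sound[rw lw vw].
apply/subgroup_languageP => //; split.
  move: ruqt rupt rw; rewrite /reduced cat_rcons !sorted_cat_cons /= cat_path -lw.
  by move=> /andP[-> _] /andP[_ ->] ->.
by rewrite !fg_eval_cat -!rtranslateM -qu -vw pu' rtranslateM -fg_eval_cat cat_rcons.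
Qed.

(** Otherwise all nonempty words of [L_H] end in [a]; so do their inverses, hence they all start
    with [linv a]. *)
Lemma conjugacy_reduced_last a : conjugacy_reduced H ->
  exists u x, subgroup_language H (rcons u x) /\ x != a.
Proof.
move=> crH; apply: contrapT => noL; apply: crH; exists a => w Lw w0.
have lastL v x : subgroup_language H (rcons v x) -> x = a.
  by move=> Lv; apply: contrapT => /eqP xa; apply: noL; exists v, x.
case/lastP: w Lw w0 => // w x Lw _.
have xa := lastL _ _ Lw; rewrite {x}xa in Lw *.
have := subgroup_language_winv subH Lw.
(* The one-letter word [a] is excluded: its inverse ends in [linv a], not in [a]. *)
case: w Lw => [|y w] Lw.
  by move=> /(lastL [::]); case: a {lastL noL Lw} => i [].
rewrite /winv /= rev_cons => /lastL ya; exists w.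
by rewrite -[y]linvK ya.
Qed.

(* A run on [y :: w] can start at any initial state [(H, x)] with [x] not inverse
   to [y]; conjugacy reducedness is what provides one. *)
Lemma core_run_exists w : conjugacy_reduced H -> w != [::] ->
  subgroup_language H w -> exists q p : state (core_automaton H), run q w = Some p.
Proof.
case: w => // y w crH _ Lw.
have [u [x [Lux xy]]] := conjugacy_reduced_last (linv y) crH.
have Hux := (subgroup_languageP subH _).1 Lux.
have [q qE] : exists q : state (core_automaton H), val q = (H, x).
  apply: core_state_exists; apply/core_state_setP => //; exists u, [::].
  by rewrite cats1 Hux.2.
exists q; apply: (@core_run_complete _ _ [::] [::]); rewrite ?cats0 ?qE//=.
  by rewrite fg_eval_nil rtranslate1.
have [rw _] := Lw; apply/andP; split=> //.
by apply: contra_neq xy => ->; rewrite linvK.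
Qed.

(** The trivial subgroup is cyclic, so [H] has a nonempty reduced word, and the run of that word
    starts at some state. *)
Lemma core_state_gt0 : ~ is_cyclic H -> conjugacy_reduced H ->
  (0 < #|state (core_automaton H)|)%N.
Proof.
move=> ncH crH; apply: contrapT => H0; apply: ncH; exists 1%g.
have H1 : H 1%g by case: subH.
apply/seteqP; split=> [g Hg|]; last by apply: smallest_sub => // _ ->.
suff -> : g = 1%g by exact: sub_gen_smallest.
apply: contrapT => g1; apply: H0.
have [||q _] := @core_run_exists (fg_word g) crH.
- by apply/eqP => g0; apply: g1; apply: val_inj.
- by split; [exact: fg_wordP|rewrite fg_eval_word].
- by apply/card_gt0P; exists q.
Qed.

End CoreRuns.

(** * Exponential growth rates *)

Section GrowthRate.
Variable R : realType.

Lemma limn_esup_inf (u : (\bar R)^nat) : limn_esup u = ereal_inf (range (esups u)).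
Proof. by rewrite limn_esup_lim; apply/cvg_lim => //; exact: cvg_esups_inf. Qed.

Lemma limn_esup_le_near (u : (\bar R)^nat) l N :
  (forall n, (N <= n)%N -> (u n <= l)%E) -> (limn_esup u <= l)%E.
Proof.
move=> ul; rewrite limn_esup_inf; apply: (@le_trans _ _ (esups u N)).
  by apply: ereal_inf_lbound; exists N.
by apply: ge_ereal_sup => _ [n /= Nn <-]; exact: ul.
Qed.

Lemma limn_esup_ge_frequently (u : (\bar R)^nat) l :
  (forall N, exists2 n, (N <= n)%N & (l <= u n)%E) -> (l <= limn_esup u)%E.
Proof.
move=> ul; rewrite limn_esup_inf; apply: le_ereal_inf_tmp => _ [N _ <-].
have [n Nn ln] := ul N; apply: le_trans ln _.
by apply: ereal_sup_ubound; exists n.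
Qed.

(** Absorbs a multiplicative constant into an arbitrarily small increase of the base. *)
Lemma geometric_domination (C x y : R) : 0 <= x -> x < y ->
  exists N, forall n, (N <= n)%N -> C * x ^+ n <= y ^+ n.
Proof.
move=> x0 xy; have y0 : 0 < y by exact: le_lt_trans xy.
have xy1 : `|x / y| < 1.
  by rewrite ger0_norm ?divr_ge0 ?(ltW y0)// ltr_pdivrMr// mul1r.
have : (fun n => C * (x / y) ^+ n) @ \oo --> (0 : R).
  by rewrite -[X in _ --> X](mulr0 C); apply: cvgMr; exact: cvg_expr.
move=> /(cvgr_lt (0:R)) /(_ 1 ltr01)[N _ NP]; exists N => n Nn.
have := NP n Nn; rewrite /= exprMn exprVn mulrA ltr_pdivrMr ?exprn_gt0// mul1r.
exact: ltW.
Qed.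

Variable b : nat -> R.
Hypothesis b_ge0 : forall n, 0 <= b n.

Definition log_rate n : \bar R := ((n%:R^-1)%:E * lne (b n)%:E)%E.

Lemma log_rateE (c : R) n : 0 < c -> (0 < n)%N ->
  ((n%:R^-1)%:E * lne (c ^+ n)%:E)%E = lne c%:E.
Proof.
move=> c0 n0; rewrite !lne_EFin ?exprn_gt0// lnXn// -EFinM -[ln c *+ n]mulr_natl mulKf//.
by rewrite pnatr_eq0 -lt0n.
Qed.

Lemma log_rate_le (c : R) n : 0 < c -> (0 < n)%N -> b n <= c ^+ n ->
  (log_rate n <= lne c%:E)%E.
Proof.
move=> c0 n0 bc; rewrite -(log_rateE c0 n0) lee_wpmul2l ?lee_fin ?invr_ge0//.
by rewrite lee_lne ?lee_fin// in_itv/= leey andbT lee_fin// exprn_ge0// ltW.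
Qed.

Lemma log_rate_ge (c : R) n : 0 < c -> (0 < n)%N -> c ^+ n <= b n ->
  (lne c%:E <= log_rate n)%E.
Proof.
move=> c0 n0 bc; rewrite -(log_rateE c0 n0) lee_wpmul2l ?lee_fin ?invr_ge0//.
by rewrite lee_lne ?lee_fin// in_itv/= leey andbT lee_fin// exprn_ge0// ltW.
Qed.

(** The lower bound is asked at only one index in each window of length [K + 1]: this suffices for a
    limsup and allows [b] to vanish at some lengths. *)
Lemma limn_esup_log_rate a K (s : R) : 0 <= s -> 0 < a ->
  (forall c, s < c -> exists C, forall n, (0 < n)%N -> b n <= C * c ^+ n) ->
  (forall n, exists2 k, (k <= K)%N & a * s ^+ n <= b (n + k)%N) ->
  limn_esup log_rate = lne s%:E.
Proof.
(* Comparing exponentials treats [s = 0], where [lne] is [-oo], together with [s > 0]. *)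
move=> s0 a0 bub blb; apply: expeR_inj.
have -> : expeR (lne s%:E) = s%:E by apply/eqP; rewrite lneK_eq lee_fin.
apply/eqP; rewrite eq_le; apply/andP; split.
  apply/lee_addgt0Pr => e e0; rewrite -EFinD.
  have se : s < (s + (s + e)) / 2 by rewrite (midf_lt _).1// ltrDl.
  have se' : (s + (s + e)) / 2 < s + e by rewrite (midf_lt _).2// ltrDl.
  have [C bC] := bub _ se.
  have [N NP] := geometric_domination C (le_trans s0 (ltW se)) se'.
  have -> : (s + e)%:E = expeR (lne (s + e)%:E).
    by apply/esym/eqP; rewrite lneK_eq lee_fin addr_ge0// ltW.
  rewrite lee_expeR; apply: (@limn_esup_le_near _ _ N.+1) => n Nn.
  have n0 : (0 < n)%N by exact: leq_ltn_trans Nn.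
  apply: log_rate_le => //; first by rewrite ltr_wpDl.
  by apply: le_trans (bC n n0) (NP _ _); exact: ltnW.
rewrite leNgt; apply/negP => Xs.
have X0 := expeR_ge0 (limn_esup log_rate).
move: (Xs) X0; case XE: (expeR _) => [r| |]//; rewrite lte_fin lee_fin => rs r0.
pose c := (r + s) / 2.
have rc : r < c by rewrite (midf_lt _).1.
have cs : c < s by rewrite (midf_lt _).2.
have c0 : 0 < c by exact: le_lt_trans rc.
suff : (c%:E <= expeR (limn_esup log_rate))%E by rewrite XE lee_fin leNgt rc.
have -> : c%:E = expeR (lne c%:E) by apply/esym/eqP; rewrite lneK_eq lee_fin ltW.
rewrite lee_expeR; apply: limn_esup_ge_frequently => M.
(* The constant absorbs both [a] and [c ^+ k] for every [k <= K], so that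
   [c ^+ (n + k) <= a * s ^+ n]. *)
have [N NP] := geometric_domination (Num.max 1 c ^+ K / a) (ltW c0) cs.
have [k kK sb] := blb (maxn M.+1 N); exists (maxn M.+1 N + k)%N.
  by rewrite (leq_trans _ (leq_addr _ _))// (leq_trans _ (leq_maxl _ _)).
apply: log_rate_ge => //; first by rewrite addn_gt0 leq_max.
apply: le_trans sb; rewrite exprD; have := NP _ (leq_maxr M.+1 N).
rewrite mulrAC ler_pdivrMr// [leRHS]mulrC => /(le_trans _); apply.
rewrite mulrC ler_wpM2r ?exprn_ge0 ?(ltW c0)//.
apply: (@le_trans _ _ (Num.max 1 c ^+ k)).
  by rewrite lerXn2r ?nnegrE ?le_max ?lexx ?orbT// ?ler01// ltW.
by rewrite ler_weXn2l// le_max lexx.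
Qed.

End GrowthRate.

(** * Adjacency matrices, runs against words, and the entropy *)

Lemma map_adjacency_mx (K L : pzRingType) (f : {rmorphism K -> L}) (S : finType)
  (D : automaton S) : map_mx f (adjacency_mx K D) = adjacency_mx L D.
Proof. by apply/matrixP => i j; rewrite !mxE rmorph_nat. Qed.

Lemma nonneg_adjacency_mx (R : numDomainType) (S : finType) (D : automaton S) :
  nonneg_mx (adjacency_mx R D).
Proof. by move=> i j; rewrite mxE ler0n. Qed.

Section TrimGrowth.
Variables (S : finType) (D : automaton S) (L : set (seq S)).
Hypothesis D_gt0 : (0 < #|state D|)%N.
Hypothesis D_extend : forall q p : state D, exists a b, forall w,
  run q w = Some p -> L (a ++ w ++ b).

(** For each [n], take the pair of states with the most runs and pad its runs to words. The padding
    [k] varies with the pair, hence with [n], but is bounded by its maximum over all pairs. *)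
Lemma sum_run_count_le_word_count : exists K, forall n,
  exists2 k, (k <= K)%N &
    (\sum_q \sum_(p : state D) run_count n q p
      <= #|{: state D * state D}| * word_count L (n + k))%N.
Proof.
have /choice[k kP] : forall qp : state D * state D, exists k, forall n,
    (run_count n qp.1 qp.2 <= word_count L (n + k))%N.
  move=> [q p]; have [a [b runL]] := D_extend q p.
  by exists (size a + size b)%N => n; exact: run_count_le_word_count.
exists (\max_qp k qp)%N => n.
have [q0 _] := card_gt0P D_gt0.
rewrite pair_big /=.
case: (@arg_maxnP _ (q0, q0) predT (fun qp => run_count n qp.1 qp.2)) => //= qp _ qpmax.
exists (k qp); first exact: leq_bigmax.
apply: (@leq_trans (#|{: state D * state D}| * run_count n qp.1 qp.2)).
  rewrite -sum_nat_const; apply: leq_sum => i _; exact: qpmax.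
by rewrite leq_mul2l kP orbT.
Qed.

End TrimGrowth.

Theorem theorem5p18 (R : realType) (m : nat) (H : set (free_group m)) :
  is_subgroup H -> finitely_generated H -> ~ is_cyclic H ->
  conjugacy_reduced H ->
  exists lambda : R,
    is_perron_frobenius_eigenvalue (core_automaton H) lambda /\
    language_entropy R (subgroup_language H) = lne lambda%:E.
Proof.
move=> subH fgH ncH crH.
set D := core_automaton H.
have D0 : (0 < #|state D|)%N := core_state_gt0 subH fgH ncH crH.
have M0 := @nonneg_adjacency_mx R _ D.
have [s [s0 sM s_sub]] := nonneg_mx_eigenvalue D0 M0.
have count_sum n := @sum_adjacency_mxX _ D R n.
exists s; split.
  split=> // z zM; rewrite (_ : `|z| = (Normc.normc z)%:C%C)// lecR.
  (* Subinvariant vectors are available only above [s], so [|z|] is compared with [s + e]. *)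
  apply/ler_addgt0Pr => e e0; have [x xM] := s_sub _ (ltr_pwDr e0 (lexx s)).
  by apply: subinvariant_complex_eigenvalue M0 xM _; rewrite map_adjacency_mx.
have [K KP] := sum_run_count_le_word_count D0 (core_run_extend subH fgH).
have [a a0 aM] := eigenvalue_sum_mxX M0 s0 sM.
have N0 : 0 < #|{: state D * state D}|%:R :> R by rewrite ltr0n card_prod muln_gt0 D0.
apply: (@limn_esup_log_rate R (fun n => (word_count (subgroup_language H) n)%:R) _
  (a / #|{: state D * state D}|%:R) K s) => //; first by rewrite divr_gt0.
  move=> c sc; have [x xM] := s_sub _ sc.
  exists (\sum_i \sum_j x 0 j / x 0 i) => n n0.
  have c0 : 0 <= c by exact: le_trans (ltW sc).
  apply: le_trans (subinvariant_sum_mxX M0 c0 xM n).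
  rewrite count_sum ler_nat; apply: word_count_le_run_count => w wn Lw.
  by apply: core_run_exists => //; rewrite -size_eq0 wn -lt0n.
move=> n; have [k kK kP] := KP n; exists k => //.
(* [a * s ^+ n] is at most the number of runs of length [n], itself at most the number of state
   pairs times the count of words of length [n + k]. *)
rewrite mulrAC ler_pdivrMr// (le_trans (aM n))// count_sum mulrC -natrM ler_nat.
exact: kP.
Qed.
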